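(* For all integers $n\geq 2$ (and all $x,y\in\mathbb{C}$), the degenerate Bernoulli polynomials satisfy $$\sum_{k=0}^n\binom{n}{k}_{c;q}\mathcal{B}_{k;q}(x)\,\mathcal{B}_{n-k;q}(y)=-(n-1)\,\mathcal{B}_{n;q}((x+y)_c)-n\,\mathcal{B}_{n-1;q}((x+y)_c)\,\frac{(n-1)-q(n-2)}{(n-1)q-(n-2)}+\widehat{\mathcal{B}_{n;q}}((x+y)_c)+(1-q)\frac{c_{n;q}}{c_{n-1;q}}\,\widehat{\mathcal{B}_{n-1;q}}((x+y)_c).$$
   Context: Fix a complex parameter $q\neq 1$ such that $jq-(j-1)\neq 0$ for all integers $j\ge 1$. Let $Q_0(q)=1$, $Q_n(q)=\prod_{j=1}^{n}(jq-(j-1))$, and $c_{0;q}=1$, $c_{n;q}=n!/Q_{n-1}(q)$ for $n\ge 1$. The Carlitz-Tsallis deformed exponential is $e_q(x)=(1+(1-q)x)^{1/(1-q)}=\sum_{n\ge 0}x^n/c_{n;q}$ (as a formal power series). Put $\binom{n}{k}_{c;q}=\frac{c_{n;q}}{c_{k;q}c_{n-k;q}}$ for $0\le k\le n$, and $(x+y)^n_c=\sum_{k=0}^n\binom{n}{k}_{c;q}x^ky^{n-k}$. The degenerate Bernoulli polynomials $\mathcal{B}_{n;q}(x)$ and numbers $\mathcal{B}_{n;q}$ are defined by the formal power series identities in $t$ $$\frac{t}{e_q(t)-1}e_q(xt)=\sum_{n\ge0}\mathcal{B}_{n;q}(x)\frac{t^n}{c_{n;q}},\qquad \frac{t}{e_q(t)-1}=\sum_{n\ge0}\mathcal{B}_{n;q}\frac{t^n}{c_{n;q}}.$$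 Define $\widehat{\mathcal{B}_{n;q}}(u)=\sum_{k=0}^n\binom{n}{k}_{c;q}\,k\,\mathcal{B}_{n-k;q}\,u^k$. For a polynomial $p(u)=\sum_k a_ku^k$, the notation $p((x+y)_c)$ means that each power $u^k$ is replaced by $(x+y)^k_c$, i.e. $p((x+y)_c)=\sum_k a_k(x+y)^k_c$. *)

(* Defs.v *)
From HB Require Import structures.
From mathcomp Require Import all_boot all_order all_algebra.
From mathcomp Require Import ring.

Set Implicit Arguments.
Unset Strict Implicit.
Unset Printing Implicit Defensive.

Import Order.TTheory GRing.Theory Num.Theory.
Local Open Scope ring_scope.

(* A formal power series \sum_n f_n t^n over R is represented by its
   coefficient sequence f : nat -> R, and series are compared by =1. *)
Section FormalPowerSeries.
Variable R : comUnitRingType.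
Implicit Types f g h : nat -> R.

Definition fps_one : nat -> R := fun n => (n == 0%N)%:R.

Definition fps_sub f g : nat -> R := fun n => f n - g n.

Definition fps_mul f g : nat -> R :=
  fun n => \sum_(i < n.+1) f i * g (n - i)%N.

Definition fps_mulX f : nat -> R := fun n => if n is m.+1 then f m else 0.

(* (f - f_0) / t *)
Definition fps_divX f : nat -> R := fun n => f n.+1.

(* The first n coefficients of 1/f, from the recursion
   f_0 g_m = [m = 0] - \sum_(i < m) f_(m-i) g_i. *)
Fixpoint fps_inv_seq f (n : nat) : seq R :=
  if n is m.+1 then
    let s := fps_inv_seq f m in
    rcons s ((f 0%N)^-1 * (fps_one m - \sum_(i < m) f (m - i)%N * s`_i))
  else [::].

Definition fps_inv f : nat -> R := fun n => (fps_inv_seq f n.+1)`_n.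

Lemma size_fps_inv_seq f n : size (fps_inv_seq f n) = n.
Proof. by elim: n => //= n IH; rewrite size_rcons IH. Qed.

Lemma nth_fps_inv_seq f n i : (i < n)%N -> (fps_inv_seq f n)`_i = fps_inv f i.
Proof.
elim: n => // n IH; rewrite ltnS leq_eqVlt => /predU1P[-> //|lt_in].
by rewrite /= nth_rcons size_fps_inv_seq lt_in IH.
Qed.

Lemma fps_invE f n :
  fps_inv f n =
  (f 0%N)^-1 * (fps_one n - \sum_(i < n) f (n - i)%N * fps_inv f i).
Proof.
rewrite {1}/fps_inv /= nth_rcons size_fps_inv_seq ltnn eqxx.
by congr (_ * (_ - _)); apply: eq_bigr => i _; rewrite nth_fps_inv_seq.
Qed.

Lemma fps_mulC f g : fps_mul f g =1 fps_mul g f.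
Proof.
move=> n; rewrite /fps_mul (reindex_inj rev_ord_inj) /=.
apply: eq_bigr => i _; rewrite subSS mulrC subKn //.
by rewrite -ltnS ltn_ord.
Qed.

Lemma fps_mulfV f : f 0%N \is a GRing.unit -> fps_mul f (fps_inv f) =1 fps_one.
Proof.
move=> f0 n; rewrite fps_mulC /fps_mul big_ord_recr /= subnn mulrC.
rewrite [in X in _ + X]fps_invE mulVKr //.
under eq_bigr => i _ do rewrite mulrC.
by rewrite addrC subrK.
Qed.

Lemma fps_mul_coef f g n N : (n < N)%N ->
  fps_mul f g n = ((\poly_(i < N) f i) * (\poly_(i < N) g i))`_n.
Proof.
move=> ltnN; rewrite coefM; apply: eq_bigr => i _; rewrite !coef_poly.
rewrite (leq_trans (ltn_ord i) ltnN).
by rewrite (leq_ltn_trans (leq_subr i n) ltnN).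
Qed.

Lemma fps_mulA f g h : fps_mul f (fps_mul g h) =1 fps_mul (fps_mul f g) h.
Proof.
move=> n.
pose p u : {poly R} := \poly_(i < n.+1) u i.
have pE u i : (i <= n)%N -> (p u)`_i = u i by move=> ?; rewrite coef_poly ltnS ifT.
transitivity (p f * (p g * p h))`_n.
  rewrite coefM; apply: eq_bigr => i _; rewrite (pE f) ?leq_ord //.
  by rewrite (@fps_mul_coef _ _ _ n.+1) // ltnS leq_subr.
rewrite mulrA coefM; apply: eq_bigr => i _.
by rewrite pE ?leq_subr // (@fps_mul_coef _ _ _ n.+1).
Qed.

Lemma eq_fps_mul f f' g g' :
  f =1 f' -> g =1 g' -> fps_mul f g =1 fps_mul f' g'.
Proof. by move=> ef eg n; apply: eq_bigr => i _; rewrite ef eg. Qed.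

Lemma fps_mul1 f : fps_mul fps_one f =1 f.
Proof.
move=> n; rewrite /fps_mul big_ord_recl /= mul1r subn0 big1 ?addr0 // => i _.
by rewrite /fps_one /= mul0r.
Qed.

Lemma fps_mulXl f g : fps_mul (fps_mulX f) g =1 fps_mulX (fps_mul f g).
Proof.
case=> [|n]; first by rewrite /fps_mul big_ord1 /= mul0r.
rewrite /fps_mul big_ord_recl /= mul0r add0r.
by apply: eq_bigr => i _; rewrite subSS.
Qed.

End FormalPowerSeries.

Section DegenerateBernoulli.
Variables (F : numFieldType) (q : F).

Definition Qfact (n : nat) : F :=
  \prod_(1 <= j < n.+1) (j%:R * q - (j%:R - 1)).

Definition cfact (n : nat) : F := if n is m.+1 then n`!%:R / Qfact m else 1.

Definition cbinom (n k : nat) : F := cfact n / (cfact k * cfact (n - k)).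

(* The deformed power (x+y)^n_c *)
Definition caddX (x y : F) (n : nat) : F :=
  \sum_(k < n.+1) cbinom n k * x ^+ k * y ^+ (n - k).

(* p((x+y)_c): umbral evaluation, each 'X^k being sent to (x+y)^k_c *)
Definition ceval (p : {poly F}) (x y : F) : F :=
  \sum_(k < size p) p`_k * caddX x y k.

(* e_q(t) = (1 + (1-q)t)^(1/(1-q)), see dexp_binomial_series *)
Definition dexp : nat -> F := fun n => (cfact n)^-1.

(* e_q(xt) in F[x][[t]], the indeterminate x being 'X *)
Definition dexpX : nat -> {poly F} := fun n => dexp n *: 'X^n.

(* t / (e_q(t) - 1): since e_q(t) - 1 has no constant term, this is the inverse
   of the series (e_q(t) - 1) / t, whose constant term is 1. *)
Definition dbern_gen : nat -> F :=
  fps_inv (fps_divX (fps_sub dexp (@fps_one F))).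

Definition dbern (n : nat) : F := cfact n * dbern_gen n.

Definition dbern_poly (n : nat) : {poly F} :=
  cfact n *: fps_mul (fun k => (dbern_gen k)%:P) dexpX n.

Definition dbern_hat (n : nat) : {poly F} :=
  \sum_(k < n.+1) (cbinom n k * k%:R * dbern (n - k)) *: 'X^k.

Lemma dexp_binomial_series n : q != 1 ->
  dexp n =
  (\prod_(j < n) ((1 - q)^-1 - j%:R)) / n`!%:R * (1 - q) ^+ n.
Proof.
move=> q1; have u0 : 1 - q != 0 by rewrite subr_eq0 eq_sym.
rewrite /dexp /cfact; case: n => [|n].
  by rewrite big_ord0 expr0 fact0 divr1 mulr1 invr1.
rewrite invf_div mulrAC; congr (_ / _).
have -> : (1 - q) ^+ n.+1 = \prod_(j < n.+1) (1 - q).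
  by rewrite big_const_ord -Monoid.iteropE.
rewrite -big_split /= big_ord_recl /= subr0 mulVf // mul1r.
rewrite /Qfact big_add1 /= big_mkord.
by apply: eq_bigr => j _; rewrite mulrBl mulVf // /bump /= natrD; ring.
Qed.

Hypothesis hq : forall j, (1 <= j)%N -> j%:R * q - (j%:R - 1) != 0.

Lemma cfact_neq0 n : cfact n != 0.
Proof.
case: n => [|n]; first exact: oner_neq0.
rewrite mulf_neq0 ?pnatr_eq0 -?lt0n ?fact_gt0 // invr_eq0 /Qfact.
rewrite big_add1 /= big_mkord.
by apply/prodf_neq0 => j _; apply: hq.
Qed.

Lemma dexp_sub1E :
  fps_sub dexp (@fps_one F) =1
  fps_mulX (fps_divX (fps_sub dexp (@fps_one F))).
Proof. by case=> [|n] //=; rewrite /fps_sub /dexp /= invr1 subrr. Qed.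

Lemma dbern_genP :
  fps_mul (fps_sub dexp (@fps_one F)) dbern_gen =1 fps_mulX (@fps_one F).
Proof.
move=> n; rewrite (eq_fps_mul dexp_sub1E (frefl _)) fps_mulXl.
case: n => //= n; rewrite fps_mulfV //.
rewrite /fps_divX /fps_sub /dexp /= /Qfact big_geq // /fps_one /=.
by rewrite !divr1 invr1 subr0 unitr1.
Qed.

(* (e_q(t) - 1) * \sum_n B_(n;q) t^n / c_(n;q) = t *)
Lemma dbernP :
  fps_mul (fps_sub dexp (@fps_one F)) (fun n => dbern n / cfact n)
  =1 fps_mulX (@fps_one F).
Proof.
move=> n; rewrite -dbern_genP; apply: eq_fps_mul => // m.
by rewrite /dbern mulrC mulKf // cfact_neq0.
Qed.

(* (e_q(t) - 1) * \sum_n B_(n;q)(x) t^n / c_(n;q) = t e_q(xt) *)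
Lemma dbern_polyP (x : F) :
  fps_mul (fps_sub dexp (@fps_one F)) (fun n => (dbern_poly n).[x] / cfact n)
  =1 fps_mulX (fun n => dexp n * x ^+ n).
Proof.
move=> n.
have E : (fun n => (dbern_poly n).[x] / cfact n)
           =1 fps_mul dbern_gen (fun n => dexp n * x ^+ n).
  move=> m; rewrite /dbern_poly hornerZ mulrC mulKf ?cfact_neq0 //.
  rewrite /fps_mul horner_sum; apply: eq_bigr => i _.
  by rewrite hornerM hornerC /dexpX hornerZ hornerXn.
rewrite (eq_fps_mul (frefl _) E) fps_mulA (eq_fps_mul dbern_genP (frefl _)).
rewrite fps_mulXl; case: n => //= n; exact: fps_mul1.
Qed.

End DegenerateBernoulli.

(* Main.v *)
From HB Require Import structures.
Require Import Defs.
From mathcomp Require Import all_boot all_order all_algebra.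
From mathcomp Require Import ring boolp functions.
From mathcomp Require Import reals.
From mathcomp Require Import complex.
Import GRing.Theory.
Local Open Scope ring_scope.
Local Open Scope complex_scope.

(** Write [e] for the deformed exponential series, [B = t / (e - 1)] for the
    Bernoulli series, [theta = t d/dt] for the Euler derivation and
    [s = 1 + (1 - q) t].  The series [e] is a power of [s] and satisfies
    [s e' = e], that is [s theta e = t e].  Applying [theta] to
    [(e - 1) B = t] and using this equation to eliminate [theta e] gives an
    equation of Riccati type for [B],
    [[ B^2 = s (B - theta B) - t B ]]
    (lemma [dbern_gen_sqr]).  Let [E] be the series with coefficients
    [(x+y)^n_c / c_n], which is the product of the two series [e_q(xt)] and
    [e_q(yt)].  Multiplying the equation by [E] and moving the derivation from
    [B] to [E] by the Leibniz rule yields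
    [[ B^2 E = s (B E - theta (B E) + B theta E) - t B E. ]]
    The theorem is the identity between the coefficients of [t^n] on both
    sides: [c_n] times the coefficient is the convolution of the Bernoulli
    polynomials for [B^2 E], the umbral value of the Bernoulli polynomial for
    [B E] ([ceval_dbern_poly]), and the umbral value of the hatted polynomial
    for [B theta E] ([ceval_dbern_hat]).  The rational factor in the statement
    comes from [c_n / c_(n-1) = n / ((n-1) q - (n-2))]. *)

(** * The ring of formal power series *)

Section SeriesRing.
Variable F : comUnitRingType.

(** A copy of [nat -> F], which carries the convolution product instead of the
    pointwise one, so that identities between series are ring identities. *)
Definition series : Type := nat -> F.

HB.instance Definition _ := GRing.Zmodule.copy series (nat -> F).

Implicit Types f g h : series.

Definition smul f g : series := fps_mul f g.

Lemma smulA : associative smul.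
Proof. by move=> f g h; apply/funext => n; apply: fps_mulA. Qed.

Lemma smulC : commutative smul.
Proof. by move=> f g; apply/funext => n; apply: fps_mulC. Qed.

Lemma smul1 : left_id (@fps_one F : series) smul.
Proof. by move=> f; apply/funext => n; apply: fps_mul1. Qed.

Lemma smulDl : left_distributive smul +%R.
Proof.
move=> f g h; apply/funext => n.
transitivity (fps_mul f h n + fps_mul g h n); last by [].
rewrite /smul /fps_mul -big_split /=.
by apply: eq_bigr => i _; rewrite -mulrDl.
Qed.

HB.instance Definition _ :=
  GRing.Zmodule_isComPzRing.Build series smulA smulC smul1 smulDl.

Definition sX : series := fps_mulX (@fps_one F).

Definition sC (a : F) : series := fun n => if n is 0%N then a else 0.

(** The Euler operator [t d/dt]. *)
Definition theta f : series := fun n => n%:R * f n.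

Lemma coefsD f g n : (f + g) n = f n + g n.
Proof. by []. Qed.

Lemma coefsB f g n : (f - g) n = f n - g n.
Proof. by []. Qed.

Lemma coefsM f g n : (f * g) n = \sum_(i < n.+1) f i * g (n - i)%N.
Proof. by []. Qed.

Lemma coefs1 n : (1 : series) n = (n == 0%N)%:R.
Proof. by []. Qed.

Lemma coefsXM f n : (sX * f) n = if n is m.+1 then f m else 0.
Proof.
transitivity (fps_mulX (fps_mul (@fps_one F) f) n).
  exact: fps_mulXl.
by case: n => //= n; apply: fps_mul1.
Qed.

Lemma coefsCM a f n : (sC a * f) n = a * f n.
Proof.
rewrite coefsM big_ord_recl subn0 big1 ?addr0 // => i _.
by rewrite mul0r.
Qed.

Lemma sX_inj : injective ( *%R sX).
Proof.
move=> f g eq_fg; apply/funext => n.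
by have := coefsXM f n.+1; rewrite eq_fg coefsXM.
Qed.

Lemma theta1 : theta 1 = 0.
Proof. by apply/funext => -[|n]; rewrite /theta coefs1 ?mul0r ?mulr0. Qed.

Lemma thetaX : theta sX = sX.
Proof.
by apply/funext => -[|[|n]]; rewrite /theta /sX /= /fps_one ?mul0r ?mulr0 ?mul1r.
Qed.

Lemma thetaB f g : theta (f - g) = theta f - theta g.
Proof. by apply/funext => n; rewrite coefsB /theta -mulrBr. Qed.

Lemma thetaM f g : theta (f * g) = theta f * g + f * theta g.
Proof.
apply/funext => n; rewrite coefsD {1}/theta !coefsM mulr_sumr -big_split /=.
apply: eq_bigr => i _; rewrite /theta.
have {1}-> : n = (i + (n - i))%N by rewrite subnKC // leq_ord.
by rewrite natrD; ring.
Qed.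

End SeriesRing.

(** * The generating series of the degenerate Bernoulli numbers *)

Section Bernoulli.
Variables (F : numFieldType) (q : F).
Hypothesis hq : forall j : nat, (1 <= j)%N -> j%:R * q - (j%:R - 1) != 0.

Local Notation t := (sX F).
Local Notation e := (dexp q : series F).
Local Notation B := (dbern_gen q : series F).

(** For [q != 1] the series [e] is the power of this one with exponent
    [1 / (1 - q)]. *)
Local Notation s := (1 + sC F (1 - q) * t).

(** At [n = 0] the convention [c_0 = 1] agrees with the recursion, as the
    factor in parentheses is then [1]. *)
Lemma cfactS n :
  cfact q n.+1 * (n%:R * q - (n%:R - 1)) = n.+1%:R * cfact q n.
Proof.
case: n => [|n]; first by rewrite /= /Qfact big_geq // (_ : 1`! = 1%N) //; field.
have hn := hq n.+1 isT.
have hQ : Qfact q n != 0.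
  rewrite /Qfact big_add1 /= big_mkord.
  by apply/prodf_neq0 => j _; apply: hq.
rewrite /= /Qfact big_nat_recr //= -/(Qfact q n) factS natrM.
by field; rewrite hQ nat1r.
Qed.

Lemma theta_dexp : s * theta F e = t * e.
Proof.
rewrite mulrDl mul1r -mulrA; apply/funext => n.
rewrite coefsD coefsCM !coefsXM /theta; case: n => [|n].
  by rewrite mulr0 addr0 mul0r.
have c0 m : cfact q m != 0 by apply: cfact_neq0.
rewrite /dexp; apply: (mulIf (mulf_neq0 (c0 n.+1) (c0 n))).
transitivity (n.+1%:R * cfact q n + (1 - q) * n%:R * cfact q n.+1).
  by field; rewrite !c0.
by rewrite -cfactS; field; rewrite c0.
Qed.

Lemma dbern_gen_mul : (e - 1) * B = t.
Proof. by apply/funext => n; apply: dbern_genP. Qed.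

(** [theta ((e - 1) B) = t] reads [theta e B = (e - 1) (B - theta B)], whose
    product with [s B] is [t e B^2 = t s (B - theta B)]; then [e B = t + B]. *)
Lemma dbern_gen_sqr : B * B = s * (B - theta F B) - t * B.
Proof.
have eAB := dbern_gen_mul; have De := theta_dexp.
have DAB : theta F e * B + (e - 1) * theta F B = t.
  by rewrite -thetaX -eAB thetaM thetaB theta1 subr0.
apply: (sX_inj F) => /=.
have eqs : t * (s * (B - theta F B) - t * B)
         = B * (s * ((e - 1) * B - (e - 1) * theta F B) - t * ((e - 1) * B)).
  by rewrite -{1}eAB; ring.
have -> : t * (s * (B - theta F B) - t * B)
        = B * (s * (theta F e * B) - t * ((e - 1) * B)).
  rewrite eqs; congr (B * (s * _ - _)).
  by rewrite eAB -{1}DAB; ring.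
by rewrite [s * _]mulrA De; ring.
Qed.

(** * Umbral evaluation and coefficient extraction *)

Lemma ceval_sum_monomials (a : nat -> F) n x y :
  ceval q (\sum_(k < n.+1) a k *: 'X^k) x y = \sum_(k < n.+1) a k * caddX q x y k.
Proof.
rewrite -poly_def /ceval; set p := \poly_(k < n.+1) a k.
rewrite (big_ord_widen n.+1 (fun k => p`_k * caddX q x y k)) ?size_poly //.
rewrite big_mkcond; apply: eq_bigr => k _ /=.
have <- : p`_k = a k by rewrite coef_poly ltn_ord.
by case: ltnP => // /(nth_default 0) ->; rewrite mul0r.
Qed.

Definition dexp_at (x : F) : series F := fun n => dexp q n * x ^+ n.

Definition dexp_add (x y : F) : series F := fun n => caddX q x y n / cfact q n.

(** The deformed power [(x+y)^n_c] is designed for this law, which replaces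
    the addition formula of the ordinary exponential. *)
Lemma dexp_addE x y : dexp_add x y = dexp_at x * dexp_at y.
Proof.
apply/funext => n; rewrite coefsM /dexp_add /caddX mulr_suml.
apply: eq_bigr => k _; rewrite /cbinom /dexp_at /dexp.
by field; rewrite !cfact_neq0.
Qed.

Lemma horner_dbern_poly n x :
  (dbern_poly q n).[x] = cfact q n * (B * dexp_at x) n.
Proof.
rewrite /dbern_poly hornerZ coefsM /fps_mul horner_sum; congr (_ * _).
by apply: eq_bigr => i _; rewrite hornerM hornerC /dexpX hornerZ hornerXn.
Qed.

Lemma dbern_poly_conv n x y :
  \sum_(k < n.+1)
     cbinom q n k * (dbern_poly q k).[x] * (dbern_poly q (n - k)).[y]
  = cfact q n * (B * B * dexp_add x y) n.
Proof.
have -> : B * B * dexp_add x y = (B * dexp_at x) * (B * dexp_at y).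
  by rewrite dexp_addE; ring.
rewrite coefsM mulr_sumr; apply: eq_bigr => k _.
by rewrite !horner_dbern_poly /cbinom; field; rewrite !cfact_neq0.
Qed.

Lemma ceval_dbern_poly n x y :
  ceval q (dbern_poly q n) x y = cfact q n * (B * dexp_add x y) n.
Proof.
have -> : dbern_poly q n
    = \sum_(k < n.+1) (cfact q n * (dexp q k * B (n - k)%N)) *: 'X^k.
  rewrite /dbern_poly fps_mulC /fps_mul scaler_sumr; apply: eq_bigr => k _.
  by rewrite /dexpX -scalerAl [_ * _%:P]mulrC mul_polyC !scalerA mulrA.
rewrite (ceval_sum_monomials (fun k => cfact q n * (dexp q k * B (n - k)%N))).
rewrite [B * _]mulrC coefsM mulr_sumr; apply: eq_bigr => k _.
by rewrite /dexp_add /dexp; ring.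
Qed.

Lemma ceval_dbern_hat n x y :
  ceval q (dbern_hat q n) x y = cfact q n * (B * theta F (dexp_add x y)) n.
Proof.
rewrite /dbern_hat.
rewrite (ceval_sum_monomials (fun k => cbinom q n k * k%:R * dbern q (n - k))).
rewrite [B * _]mulrC coefsM mulr_sumr; apply: eq_bigr => k _.
rewrite /cbinom /dbern /theta /dexp_add.
by field; rewrite !cfact_neq0.
Qed.

(** By the Leibniz rule [theta B E = theta (B E) - B theta E]: the Euler
    operator multiplies the coefficients of [B E] by their index, and
    [B theta E] is the series behind the hatted polynomials. *)
Lemma dbern_gen_sqr_mul (E : series F) :
  B * B * E = s * (B * E - theta F (B * E) + B * theta F E) - t * (B * E).
Proof. by rewrite dbern_gen_sqr thetaM; ring. Qed.

Lemma dbern_poly_conv_ceval n x y : (2 <= n)%N ->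
  \sum_(k < n.+1)
     cbinom q n k * (dbern_poly q k).[x] * (dbern_poly q (n - k)).[y]
  = - (n%:R - 1) * ceval q (dbern_poly q n) x y
    - n%:R * ceval q (dbern_poly q (n - 1)) x y
        * (((n%:R - 1) - q * (n%:R - 2)) / ((n%:R - 1) * q - (n%:R - 2)))
    + ceval q (dbern_hat q n) x y
    + (1 - q) * (cfact q n / cfact q (n - 1))
        * ceval q (dbern_hat q (n - 1)) x y.
Proof.
case: n => [|[|m]] // _; rewrite subn1 [m.+2.-1]/=.
rewrite dbern_poly_conv dbern_gen_sqr_mul mulrDl mul1r -mulrA.
rewrite !(coefsB, coefsD) coefsCM !coefsXM !(coefsB, coefsD) /theta -/(theta F).
rewrite !ceval_dbern_poly !ceval_dbern_hat.
have hc := cfactS m.+1; have hm := hq m.+1 isT.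
have c0 : cfact q m.+1 != 0 by apply: cfact_neq0.
have mE : m.+2%:R = m.+1%:R + 1 :> F by rewrite -addn1 natrD.
have -> : cfact q m.+2
    = m.+2%:R * cfact q m.+1 / (m.+1%:R * q - (m.+1%:R - 1)).
  by rewrite -hc mulfK.
by rewrite mE; field; rewrite c0 nat1r.
Qed.

End Bernoulli.

Theorem theorem3p6 (R : realType) (q : R[i])
  (hq1 : q != 1)
  (hq : forall j : nat, (1 <= j)%N -> j%:R * q - (j%:R - 1) != 0)
  (n : nat) (hn : (2 <= n)%N) (x y : R[i]) :
  \sum_(k < n.+1)
     cbinom q n k * (dbern_poly q k).[x] * (dbern_poly q (n - k)).[y]
  = - (n%:R - 1) * ceval q (dbern_poly q n) x y
    - n%:R * ceval q (dbern_poly q (n - 1)) x y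
        * (((n%:R - 1) - q * (n%:R - 2)) / ((n%:R - 1) * q - (n%:R - 2)))
    + ceval q (dbern_hat q n) x y
    + (1 - q) * (cfact q n / cfact q (n - 1))
        * ceval q (dbern_hat q (n - 1)) x y.
Proof. exact: dbern_poly_conv_ceval. Qed.
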